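(* Let $n \geq 1$, $p_0 \in [0,1)$ and $\theta \in (0,(1-p_0)/n]$. Let $${\cal A}_\theta = \{p=(p_1,\ldots,p_n) \in (0,1)^n \mid p_1+\cdots+p_n = 1-p_0,\ p_j \geq \theta \text{ for every } j=1,\ldots,n\},$$ let $\gamma = 1-p_0-(n-1)\theta$, and let ${\cal B}_\theta$ be the set of the $n$ vectors having one entry equal to $\gamma$ and all other $n-1$ entries equal to $\theta$, i.e. ${\cal B}_\theta = \{(\gamma,\theta,\ldots,\theta),(\theta,\gamma,\theta,\ldots,\theta),\ldots,(\theta,\ldots,\theta,\gamma)\}$. Then for every $p \in {\cal A}_\theta$, every $c=1,\ldots,n$ and every $q \in {\cal B}_\theta$, we have $T_{c,n}(p) \leq_{\rm st} T_{c,n}(q)$.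
   Context: For a vector $r=(r_1,\ldots,r_n)$ with nonnegative entries and $\sum_{i=1}^n r_i \leq 1$, set $r_0 = 1-\sum_{i=1}^n r_i$. At each discrete time $1,2,\ldots$ a coupon is drawn independently, with replacement, from $\{0,1,\ldots,n\}$, coupon $i$ being drawn with probability $r_i$ (coupon $0$ is a ''null coupon'' that never counts toward the collection). For $1 \leq c \leq n$, $T_{c,n}(r)$ denotes the number of draws needed until, for the first time, $c$ distinct coupons among $\{1,\ldots,n\}$ have been obtained. For real random variables $X,Y$, $X \leq_{\rm st} Y$ means $\Pr\{X>t\} \leq \Pr\{Y>t\}$ for all real $t$. *)

(* Defs.v *)
From HB Require Import structures.
From mathcomp Require Import all_boot all_order all_algebra.
From mathcomp Require Import all_classical all_reals all_analysis.

Set Implicit Arguments.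
Unset Strict Implicit.
Unset Printing Implicit Defensive.

Import Order.TTheory GRing.Theory Num.Theory.

Local Open Scope classical_set_scope.
Local Open Scope ring_scope.

HB.instance Definition _ (n : nat) := isPointed.Build 'I_n.+1 ord0.
(* The discrete sigma-algebra on {0, ..., n}, so that coupon draws can be
   random variables. *)
HB.instance Definition _ (n : nat) := @isMeasurable.Build
  default_measure_display 'I_n.+1 discrete_measurable discrete_measurable0
  discrete_measurableC discrete_measurableU.

Definition mutually_independent (d d' : measure_display)
    (Om : measurableType d) (S : measurableType d') (R : realType)
    (P : probability Om R) (X : nat -> {RV P >-> S}) : Prop :=
  forall (J : seq nat) (A : nat -> set S),
    uniq J -> (forall k, measurable (A k)) ->
    P (\bigcap_(k in [set` J]) (X k @^-1` A k)) =
    (\prod_(k <- J) P (X k @^-1` A k))%E.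

Definition st_le (R : realType) (d d' : measure_display)
    (Om : measurableType d) (Om' : measurableType d')
    (P : probability Om R) (P' : probability Om' R)
    (U : Om -> \bar R) (V : Om' -> \bar R) : Prop :=
  forall t : R,
    (P [set w | t%:E < U w] <= P' [set w | t%:E < V w])%E.

(* Among the coupons {0, ..., n} : 'I_n.+1, the null coupon is ord0, and the
   coupon whose probability is the entry j : 'I_n of r is lift ord0 j. *)
Definition coupon_prob (R : realType) (n : nat) (r : 'rV[R]_n)
    (i : 'I_n.+1) : R :=
  if unlift ord0 i is Some j then r 0 j else 1 - \sum_(j < n) r 0 j.

(* X k is the draw made at time k + 1. *)
Definition coupon_draws (R : realType) (n : nat) (r : 'rV[R]_n)
    (d : measure_display) (Om : measurableType d) (P : probability Om R)
    (X : nat -> {RV P >-> 'I_n.+1}) : Prop :=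
  mutually_independent X /\
  (forall (k : nat) (i : 'I_n.+1),
     P (X k @^-1` [set i]) = (coupon_prob r i)%:E).

Definition collected (n : nat) (x : nat -> 'I_n.+1) (m : nat) : {set 'I_n} :=
  [set j : 'I_n | [exists k : 'I_m, x k == lift ord0 j]]%SET.

(* T_{c,n}; it equals +oo at the outcomes where c distinct coupons are never
   obtained. *)
Definition collection_time (R : realType) (n : nat) (d : measure_display)
    (Om : measurableType d) (P : probability Om R) (c : nat)
    (X : nat -> {RV P >-> 'I_n.+1}) (w : Om) : \bar R :=
  ereal_inf [set (m%:R : R)%:E |
             m in [set m : nat | (c <= #|collected (fun k => X k w) m|)%N]].

Definition A_ (R : realType) (n : nat) (p0 theta : R) : set 'rV[R]_n :=
  [set p | [/\ forall j, 0 < p 0 j < 1,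
               \sum_(j < n) p 0 j = 1 - p0 &
               forall j, theta <= p 0 j]].

Definition gamma_ (R : realType) (n : nat) (p0 theta : R) : R :=
  1 - p0 - (n%:R - 1) * theta.

Definition B_ (R : realType) (n : nat) (p0 theta : R) : set 'rV[R]_n :=
  [set \row_(i < n) (if i == j then gamma_ n p0 theta else theta)
  | j in [set: 'I_n]].

(* Main.v *)
(* Pr(T > t) is the probability that the first m = floor(t) draws contain fewer
   than c distinct non-null coupons.  This probability increases when the
   entries (a, b) of two coupons i, j are spread out to (u, v), where u <= a, b
   and u + v = a + b.  Indeed, let l be the number of the other distinct
   coupons that occur.  The contribution of l + 2 < c depends on a + b only; the
   event that i and j both fail to occur has a weight independent of a and b;
   there remains l + 2 = c, which contributes h(a) + h(b) with h a polynomial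
   with nonnegative coefficients, and a^k + b^k <= u^k + v^k.  Lowering one
   after the other the entries of p to theta, and moving the excess to the
   position of gamma, leads from p to q. *)
Require Import Defs.
From mathcomp Require Import all_boot all_order all_algebra.
From mathcomp Require Import all_classical all_reals all_analysis.
From mathcomp Require Import perm zify ring lra.

Set Implicit Arguments.
Unset Strict Implicit.

Import Order.TTheory GRing.Theory Num.Theory.

Local Open Scope classical_set_scope.
Local Open Scope ring_scope.

(** * A power inequality and the weights of words *)

(** Both differences [b ^+ k - u ^+ k] and [v ^+ k - a ^+ k] have the factor [b - u = v - a]. The
    cofactors compare term by term, since [b <= v] and [u <= a]. *)
Lemma exprD_le_spread (R : realType) (a b u v : R) (k : nat) :
  0 <= u -> u <= a -> u <= b -> u + v = a + b ->
  a ^+ k + b ^+ k <= u ^+ k + v ^+ k.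
Proof.
move=> u0 ua ub uv.
suff : b ^+ k - u ^+ k <= v ^+ k - a ^+ k by lra.
have bu : b - u = v - a by lra.
rewrite !subrXX bu ler_wpM2l//; first lra.
apply: ler_sum => i _; apply: ler_pM; rewrite ?exprn_ge0//; try lra.
  by apply: lerXn2r; rewrite ?nnegrE; lra.
by apply: lerXn2r; rewrite ?nnegrE; lra.
Qed.

(** When [r] is a law, this is the probability of the word [f] under independent draws. Total mass 1
    is not imposed, so that some letters can be given weight 0. *)
Definition word_weight (R : realType) (T : finType) (m : nat) (r : T -> R)
  (f : {ffun 'I_m -> T}) : R := \prod_(k < m) r (f k).

Definition few_distinct_prob (R : realType) (T : finType) (D : {set T})
    (m c : nat) (r : T -> R) : R :=
  \sum_(f : {ffun 'I_m -> T}) word_weight r f *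
    (#|D :&: [set f k | k in 'I_m]|%SET < c)%:R.

(** Group the words by their image: distributivity turns the sum over the words above [g] into a
    product of sums over the fibres of [pi]. *)
Lemma sum_word_weight_pushforward (R : realType) (T : finType) (m : nat)
    (r : T -> R) (pi : T -> T) (Phi : {ffun 'I_m -> T} -> R) :
  \sum_f word_weight r f * Phi [ffun k => pi (f k)] =
  \sum_g word_weight (fun y => \sum_(x | pi x == y) r x) g * Phi g.
Proof.
rewrite (partition_big (fun f : {ffun 'I_m -> T} => [ffun k => pi (f k)])
  predT)//=.
apply: eq_bigr => g _.
rewrite {2}/word_weight bigA_distr_big_dep big_distrl/=.
apply: eq_big => f.
  apply/eqP/familyP => [<- k|fg]; first by rewrite -topredE/= ffunE.
  by apply/ffunP => k; rewrite ffunE; apply/eqP; exact: fg.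
by move=> /eqP ->.
Qed.

(** * Effect of spreading the weights of two letters *)

Section spread.
Variables (R : realType) (T : finType) (D : {set T}) (i j : T) (m : nat).
Hypotheses (iD : i \in D) (jD : j \in D) (ij : i != j).
Implicit Types (r s : T -> R) (f : {ffun 'I_m -> T}).

Let count f := #|D :&: [set f k | k in 'I_m]|%SET.
Let rest f := #|(D :\ i :\ j) :&: [set f k | k in 'I_m]|%SET.
Let missed (x : T) f : R := (x \notin [set f k | k in 'I_m]%SET)%:R.

Lemma count_rest f :
  count f = (rest f + (i \in [set f k | k in 'I_m]%SET)
                    + (j \in [set f k | k in 'I_m]%SET))%N.
Proof.
rewrite /count /rest; set S := finset.imset _ _.
rewrite (cardsD1 i) (cardsD1 j (D :&: S :\ i)%SET) !inE iD jD eq_sym ij /=.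
rewrite addnA addnC addnA; congr (_ + _ + _)%N.
apply: eq_card => x; rewrite !inE.
by case: (x == i); case: (x == j); case: (x \in D).
Qed.

(* With [a], [b] the indicators of [missed i], [missed j], the middle case uses
   that [i] and [j] do not both occur iff [a + b - a * b = 1]. *)
Lemma count_lt_decomp (c : nat) f :
  (count f < c)%:R = (rest f + 2 < c)%:R
    + (rest f + 2 == c)%:R * (missed i f + missed j f)
    + ((rest f + 1 == c)%:R - (rest f + 2 == c)%:R) * (missed i f * missed j f)
  :> R.
Proof.
rewrite /missed count_rest; move: (rest f) => a.
have [ac|ac|<-] := ltngtP (a + 2)%N c.
- have /negPf -> : (a + 1)%N != c by lia.
  have -> : (a + (i \in [set f k | k in 'I_m]%SET)
     + (j \in [set f k | k in 'I_m]%SET) < c)%N by lia.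
  rewrite ?mulr0n ?mulr1n; ring.
- have [<-|ac1] := eqVneq (a + 1)%N c.
    by case: (i \in _); case: (j \in _) => /=;
      rewrite ?addn0 ?addn1 ?addn2 ltnS ?ltnn ?leqnn ?ltnS ?ltnn;
      do ?(have -> : (a.+1 < a)%N = false by lia); rewrite ?mulr0n ?mulr1n; ring.
  have -> : (a + (i \in [set f k | k in 'I_m]%SET)
     + (j \in [set f k | k in 'I_m]%SET) < c)%N = false by lia.
  rewrite ?mulr0n ?mulr1n; ring.
- have /negPf -> : (a + 1)%N != (a + 2)%N by lia.
  case: (i \in _); case: (j \in _) => /=;
    rewrite ?addn0 ?addn1 ?addn2 ?ltnn ?ltnS ?leqnn ?leqnSn; rewrite ?mulr0n ?mulr1n; ring.
Qed.

Lemma missed_prod x f : missed x f = \prod_(k < m) (f k != x)%:R.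
Proof.
rewrite /missed; have [/imsetP[k _ ->]|xf] := boolP (x \in _).
  by rewrite (bigD1 k)//= eqxx mul0r.
rewrite big1// => k _; case: eqP => // fkx.
by move: xf; rewrite -fkx imset_f.
Qed.

(** Missing [x] is a condition on each letter separately, so the weight absorbs it. *)
Lemma weight_missed x r f :
  word_weight r f * missed x f = word_weight (fun y => r y * (y != x)%:R) f.
Proof. by rewrite missed_prod /word_weight -big_split. Qed.

Let merge (x : T) := if x == j then i else x.

Lemma rest_merge f : rest [ffun k => merge (f k)] = rest f.
Proof.
apply: eq_card => x; rewrite !inE.
have [//|xj] := eqVneq x j; have [//|xi] := eqVneq x i => /=.
congr (_ && _); apply/imsetP/imsetP => -[k _ xk]; exists k => //.
  by move: xk xi; rewrite ffunE /merge; case: eqP => // _ ->; rewrite eqxx.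
by rewrite ffunE /merge -xk (negPf xj).
Qed.

Lemma rest_perm f : rest [ffun k => tperm i j (f k)] = rest f.
Proof.
apply: eq_card => x; rewrite !inE.
have [//|xj] := eqVneq x j; have [//|xi] := eqVneq x i => /=.
congr (_ && _); apply/imsetP/imsetP => -[k _ xk]; exists k => //.
  by rewrite -(tpermK i j (f k)); move: xk; rewrite ffunE => <-;
     rewrite tpermD// eq_sym.
by rewrite ffunE -xk tpermD// eq_sym.
Qed.

(* Replacing [j] by [i] in a word does not change [rest], so only the total
   weight of [i] and [j] matters. *)
Lemma sum_word_weight_merge r s (phi : nat -> R) :
  r i + r j = s i + s j -> (forall x, x != i -> x != j -> r x = s x) ->
  \sum_f word_weight r f * phi (rest f) = \sum_f word_weight s f * phi (rest f).
Proof.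
move=> rs_ij rs.
have mergeE t : \sum_f word_weight t f * phi (rest f) =
   \sum_f word_weight t f * phi (rest [ffun k => merge (f k)]).
  by apply: eq_bigr => f _; rewrite rest_merge.
rewrite !mergeE.
rewrite (sum_word_weight_pushforward r merge (fun f => phi (rest f))).
rewrite (sum_word_weight_pushforward s merge (fun f => phi (rest f))).
apply: eq_bigr => f _; congr (_ * _); apply: eq_bigr => k _.
(* The fibre of [merge] over [i] is [{i, j}]; all other fibres contain neither [i] nor [j]. *)
have [fi|fi] := eqVneq (f k) i.
  have mE x : (merge x == f k) = (x == i) || (x == j).
    by rewrite fi /merge; case: (x =P j) => [_|]; rewrite ?eqxx ?orbT ?orbF.
  rewrite !(eq_bigl _ _ mE) (bigD1 i) ?eqxx//= (bigD1 j) ?eqxx ?orbT//=;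
    last by rewrite eq_sym.
  rewrite [RHS](bigD1 i) ?eqxx//= [in RHS](bigD1 j) ?eqxx ?orbT//=;
    last by rewrite eq_sym.
  rewrite !big_pred0; first by rewrite !addr0.
    by move=> x; case: (x == i); case: (x == j).
  by move=> x; case: (x == i); case: (x == j).
apply: eq_bigr => x; rewrite /merge; have [_ /eqP e|xj /eqP xf] := eqVneq x j.
  by rewrite e eqxx in fi.
by apply: rs => //; rewrite xf.
Qed.

(** After exchanging [i] and [j] in the words that miss [i], only words without [j] remain. One with
    [N] letters [i] has coefficient [(t i ^+ N + t j ^+ N) * W], where [W] is the same for [t = r]
    and [t = s]; [exprD_le_spread] concludes. *)
Lemma sum_word_weight_spread r s (phi : nat -> R) :
  (forall x, x != i -> x != j -> 0 <= r x) -> (forall a, 0 <= phi a) ->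
  0 <= s i -> s i <= r i -> s i <= r j -> s i + s j = r i + r j ->
  (forall x, x != i -> x != j -> s x = r x) ->
  \sum_f word_weight r f * (phi (rest f) * (missed i f + missed j f)) <=
  \sum_f word_weight s f * (phi (rest f) * (missed i f + missed j f)).
Proof.
move=> r0 phi0 si0 sri srj srij sr.
(* The transposition of [i] and [j] turns words missing [i] into words missing
   [j], so that both sums run over the same words. *)
have swap t : \sum_f word_weight t f * (phi (rest f) * (missed i f + missed j f))
    = \sum_f (word_weight (fun y => t (tperm i j y) * (y != j)%:R) f
          + word_weight (fun y => t y * (y != j)%:R) f) * phi (rest f).
  under eq_bigr do rewrite mulrCA mulrC mulrDr !weight_missed mulrDl.
  rewrite big_split/=; under [RHS]eq_bigr do rewrite mulrDl.
  rewrite [RHS]big_split/=; congr (_ + _).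
  have perm_inj : injective (fun f => [ffun k => tperm i j (f k)] : {ffun 'I_m -> T}).
    move=> f g /ffunP fg; apply/ffunP => k; have := fg k; rewrite !ffunE.
    exact: perm_inj.
  rewrite (reindex_inj perm_inj); apply: eq_bigr => f _.
  rewrite rest_perm; congr (_ * _); apply: eq_bigr => k _; rewrite ffunE.
  by rewrite -{3}(tpermR i j) (inj_eq (@perm.perm_inj _ _)).
rewrite !swap; apply: ler_sum => f _; apply: ler_wpM2r; first exact: phi0.
(* A word containing [j] has weight 0 on both sides. *)
have [/imsetP[k _ jk]|jf] := boolP (j \in [set f k | k in 'I_m]%SET).
  have z (t : T -> R) : word_weight (fun y => t y * (y != j)%:R) f = 0.
    by rewrite /word_weight (bigD1 k)//= -jk eqxx mulr0 mul0r.
  by rewrite (z s) (z r) (z (fun y => s (tperm i j y)))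
    (z (fun y => r (tperm i j y))).
pose N := #|[set k | f k == i]%SET|.
pose W := \prod_(k < m | f k != i) r (f k).
have fj k : f k != j by apply: contra jf => /eqP <-; rewrite imset_f.
have WE (t : T -> R) : (forall x, x != i -> x != j -> t x = r x) ->
    word_weight (fun y => t y * (y != j)%:R) f = t i ^+ N * W.
  move=> tr; rewrite /word_weight (bigID (fun k => f k == i))/=; congr (_ * _).
    under eq_bigr => k /eqP -> do rewrite ij mulr1.
    by rewrite prodr_const; congr (_ ^+ _); apply: eq_card => k; rewrite !inE.
  by apply: eq_bigr => k fki; rewrite fj mulr1 tr.
rewrite (WE s)// (WE r)// !WE; first last.
- by move=> x xi xj; rewrite tpermD// eq_sym.
- by move=> x xi xj; rewrite tpermD ?sr// eq_sym.
rewrite !tpermL -!mulrDl ler_wpM2r//.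
  by apply: prodr_ge0 => k fki; apply: r0.
rewrite addrC [leRHS]addrC; exact: exprD_le_spread.
Qed.

(** The three summands of [count_lt_decomp] are compared separately. The first is unchanged by
    merging [i] and [j], the second can only grow, and the third is unchanged because [i] and [j]
    get weight 0 in it. *)
Lemma few_distinct_prob_spread (c : nat) r s :
  (forall x, x != i -> x != j -> 0 <= r x) ->
  0 <= s i -> s i <= r i -> s i <= r j -> s i + s j = r i + r j ->
  (forall x, x != i -> x != j -> s x = r x) ->
  few_distinct_prob D m c r <= few_distinct_prob D m c s.
Proof.
move=> r0 si0 sri srj srij sr; rewrite /few_distinct_prob.
under eq_bigr do rewrite count_lt_decomp 2![word_weight _ _ * _]mulrDr.
under [leRHS]eq_bigr do rewrite count_lt_decomp 2![word_weight _ _ * _]mulrDr.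
rewrite !big_split/= !lerD//.
- rewrite (sum_word_weight_merge (s := s) (fun a => (a + 2 < c)%:R))//.
  by move=> x xi xj; rewrite sr.
- exact: (sum_word_weight_spread (phi := fun a => (a + 2 == c)%:R : R)).
- apply: ler_sum => f _; rewrite ![_ * (missed i f * _)]mulrC !mulrA !weight_missed.
  rewrite le_eqVlt; apply/orP; left; apply/eqP; congr (_ * _).
  apply: eq_bigr => k _; have [->|fi] := eqVneq (f k) i; first by rewrite !mulr0 !mul0r.
  have [->|fj] := eqVneq (f k) j; first by rewrite !mulr0.
  by rewrite sr.
Qed.
End spread.

(** * From collection times to sums over words *)

Lemma collected_subset (n : nat) (x : nat -> 'I_n.+1) (m m' : nat) :
  (m <= m')%N -> (collected x m \subset collected x m')%SET.
Proof.
move=> mm'; apply/fintype.subsetP => j; rewrite !inE => /existsP[k xk].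
by apply/existsP; exists (widen_ord mm' k).
Qed.

Lemma card_collected (n : nat) (x : nat -> 'I_n.+1) (m : nat)
    (f : {ffun 'I_m -> 'I_n.+1}) : (forall k : 'I_m, x k = f k) ->
  #|collected x m| = #|[set~ ord0] :&: [set f k | k in 'I_m]|%SET.
Proof.
move=> xf; rewrite -(card_imset (collected x m) (@lift_inj _ ord0)).
apply: eq_card => y; rewrite !inE; apply/imsetP/andP => [[j]|[y0 /imsetP[k _ yk]]].
  rewrite inE => /existsP[k /eqP xk] ->; split; first by rewrite eq_sym neq_lift.
  by apply/imsetP; exists k => //; rewrite -xf.
have [j|] := unliftP ord0 y; last by move=> y0'; rewrite y0' eqxx in y0.
move=> yj; exists j => //; rewrite inE; apply/existsP; exists k.
by rewrite xf -yk yj.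
Qed.

Section collection_time.
Variables (R : realType) (n : nat) (d : measure_display)
  (Om : measurableType d) (P : probability Om R) (X : nat -> {RV P >-> 'I_n.+1}).

(** The collected set grows with the number of draws, so a shortage after [Num.truncn t] draws
    excludes every earlier time and forces the infimum to be at least [(Num.truncn t).+1], which
    exceeds [t]. *)
Lemma lt_collection_time (c : nat) (t : R) (w : Om) : 0 <= t ->
  (t%:E < collection_time c X w)%E =
  (#|collected (fun k => X k w) (Num.truncn t)| < c)%N.
Proof.
move=> t0; have /andP[tt tt1] := truncn_itv t0.
have [cm|mc] := leqP c.
  apply/negbTE; rewrite -leNgt; apply: ge_ereal_inf.
  exists (Num.truncn t)%:R%:E => //.
  by exists (Num.truncn t).
apply: (@lt_le_trans _ _ (Num.truncn t).+1%:R%:E); first by rewrite lte_fin.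
apply/ereal_infP => _ [m' /= cm' <-]; rewrite lee_fin ler_nat ltnNge.
apply/negP => m't; move: mc; rewrite ltnNge => /negP; apply.
exact: leq_trans cm' (subset_leq_card (collected_subset _ m't)).
Qed.

Lemma collection_time_ge0 (c : nat) (w : Om) : (0 <= collection_time c X w)%E.
Proof. by apply/ereal_infP => _ [m' /= _ <-]; rewrite lee_fin. Qed.

Lemma measurable_draw (k : nat) (A : set 'I_n.+1) : measurable (X k @^-1` A).
Proof. exact: measurable_funPTI. Qed.

Lemma prob_word (r : 'rV[R]_n) (m : nat) (f : {ffun 'I_m -> 'I_n.+1}) :
  coupon_draws r X ->
  P [set w | forall k : 'I_m, X k w = f k] =
  (word_weight (coupon_prob r) f)%:E.
Proof.
move=> [Xind Xr].
(* Independence needs events indexed by all of [nat]; the value [setT] from time [m] on is only a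
   filler. *)
pose A k := if insub k is Some k' then [set f k'] else setT.
have AE (k : 'I_m) : A k = [set f k] by rewrite /A valK.
have -> : [set w | forall k : 'I_m, X k w = f k] =
    \bigcap_(k in [set` iota 0 m]) (X k @^-1` A k).
  apply/seteqP; split => w /= Xf k.
    rewrite /= mem_iota add0n /= => km.
    by have := AE (Ordinal km); rewrite /= => ->; exact: (Xf (Ordinal km)).
  have := Xf k; rewrite /= mem_iota add0n ltn_ord => /(_ isT).
  by rewrite AE.
rewrite Xind ?iota_uniq//.
rewrite -[X in iota 0 X]subn0 -/(index_iota 0 m) big_mkord.
rewrite /word_weight -prodEFin; apply: eq_bigr => k _.
by rewrite AE Xr.
Qed.

Lemma prob_few_collected (r : 'rV[R]_n) (m c : nat) :
  coupon_draws r X ->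
  P [set w | (#|collected (fun k => X k w) m| < c)%N] =
  (few_distinct_prob [set~ ord0]%SET m c (coupon_prob r))%:E.
Proof.
move=> Xr.
pose E (f : {ffun 'I_m -> 'I_n.+1}) := [set w | forall k : 'I_m, X k w = f k].
pose few (f : {ffun 'I_m -> 'I_n.+1}) :=
  (#|[set~ ord0] :&: [set f k | k in 'I_m]|%SET < c)%N.
have mE f : measurable (E f).
  have -> : E f = \bigcap_(k in [set: 'I_m]) (X k @^-1` [set f k]).
    by apply/seteqP; split => w /= Ef k; [move=> _|]; exact: Ef.
  by apply: fin_bigcap_measurable => // k _; exact: measurable_draw.
(* The event is split according to the word of the first [m] draws. Excluded words contribute
   [set0], matching the zero indicators in [few_distinct_prob]. *)
have -> : [set w | (#|collected (fun k => X k w) m| < c)%N] =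
    \bigcup_(f in [set` index_enum {ffun 'I_m -> 'I_n.+1}])
      (if few f then E f else set0).
  apply/seteqP; split => w /=.
    move=> cc; exists [ffun k : 'I_m => X k w]; rewrite /= ?mem_index_enum//.
    by rewrite /few -(@card_collected _ (fun k => X k w)) ?cc => k; rewrite ffunE.
  by move=> [f _]; case: ifPn => // ff Ef; rewrite (@card_collected _ _ _ f).
rewrite measure_fin_bigcup//; last first.
- by move=> f _; case: ifPn.
- move=> f g _ _ [w []]; case: ifPn => // _ Ef; case: ifPn => // _ Eg.
  by apply/ffunP => k; rewrite -Ef -Eg.
rewrite -fsbig_seq ?index_enum_uniq// -sumEFin; apply: eq_bigr => f _.
rewrite -/(few f).
by case: ifPn => _; rewrite ?mulr1 ?mulr0 ?measure0//; exact: prob_word.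
Qed.

End collection_time.

(** * Reaching the extreme vector by successive spreadings *)

Lemma coupon_prob_lift (R : realType) (n : nat) (r : 'rV[R]_n) (j : 'I_n) :
  coupon_prob r (lift ord0 j) = r 0 j.
Proof. by rewrite /coupon_prob liftK. Qed.

(** Induction on the number of positions other than [j0] whose entry is not [theta]. *)
Lemma few_distinct_prob_le_extreme (R : realType) (n m c : nat) (theta : R)
    (j0 : 'I_n) (p q : 'rV[R]_n) :
  0 <= theta -> (forall j, theta <= p 0 j) -> \sum_j p 0 j <= 1 ->
  (forall j, j != j0 -> q 0 j = theta) -> \sum_j q 0 j = \sum_j p 0 j ->
  few_distinct_prob [set~ ord0]%SET m c (coupon_prob p) <=
  few_distinct_prob [set~ ord0]%SET m c (coupon_prob q).
Proof.
move=> theta0; have [N] := ubnP #|[set i | (i != j0) && (p 0 i != theta)]|%SET.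
elim: N p => // N IH p leN p_ge p_sum q_theta q_sum.
have [i /andP[ij0 pi]|] := pickP (fun i => (i != j0) && (p 0 i != theta)); last first.
  move=> p_theta.
  have p_thetaE j : j != j0 -> p 0 j = theta.
    by move=> jj0; have := p_theta j; rewrite jj0 /= => /negbFE/eqP.
  suff -> : q = p by [].
  apply/rowP => j; have [->|jj0] := eqVneq j j0; last by rewrite q_theta// p_thetaE.
  move: q_sum; rewrite (bigD1 j0)//= [RHS](bigD1 j0)//=.
  have -> : \sum_(k < n | k != j0) q 0 k = \sum_(k < n | k != j0) p 0 k.
    by apply: eq_bigr => k kj0; rewrite q_theta// p_thetaE.
  exact: addIr.
(* The excess [p 0 i - theta] moves from [i] to [j0]: a spreading with lower value [theta] that
   preserves the sum. *)
pose p' := \row_k (if k == i then theta else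
  if k == j0 then p 0 i + p 0 j0 - theta else p 0 k).
have p'i : p' 0 i = theta by rewrite mxE eqxx.
have p'j0 : p' 0 j0 = p 0 i + p 0 j0 - theta.
  by rewrite mxE eq_sym (negPf ij0) eqxx.
have p'k k : k != i -> k != j0 -> p' 0 k = p 0 k.
  by move=> ki kj0; rewrite mxE (negPf ki) (negPf kj0).
have p'_sum : \sum_j p' 0 j = \sum_j p 0 j.
  rewrite (bigD1 i)//= [RHS](bigD1 i)//= (bigD1 j0) 1?eq_sym//=
    [in RHS](bigD1 j0) 1?eq_sym//= p'i p'j0.
  have -> : \sum_(k < n | (k != i) && (k != j0)) p' 0 k =
     \sum_(k < n | (k != i) && (k != j0)) p 0 k.
    by apply: eq_bigr => k /andP[ki kj0]; exact: p'k.
  ring.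
have [pi_ge pj0_ge] := (p_ge i, p_ge j0).
apply: (@le_trans _ _
    (few_distinct_prob [set~ ord0]%SET m c (coupon_prob p'))).
  apply: (@few_distinct_prob_spread _ _ _ (lift ord0 i) (lift ord0 j0));
    rewrite ?inE ?coupon_prob_lift ?p'i ?p'j0//.
  (* The null coupon is one of the other letters; its weight is nonnegative because the entries of
     [p] sum to at most 1. *)
  - move=> x _ _; rewrite /coupon_prob; case: unlift => [k|]; last by rewrite subr_ge0.
    exact: le_trans (p_ge k).
  - by ring.
  - move=> x; have [k ->|->] := unliftP ord0 x; last first.
      by rewrite /coupon_prob unlift_none p'_sum.
    by rewrite !(inj_eq lift_inj) !coupon_prob_lift; exact: p'k.
apply: IH => //; first last.
- by rewrite p'_sum.
- by rewrite p'_sum.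
- move=> k; have [->|ki] := eqVneq k i; first by rewrite p'i.
  have [->|kj0] := eqVneq k j0; first by rewrite p'j0; lra.
  by rewrite p'k.
rewrite -ltnS; apply: leq_trans leN; rewrite ltnS; apply: proper_card.
apply/properP; split; last by exists i; rewrite !inE ij0// p'i eqxx.
apply/fintype.subsetP => k; rewrite !inE => /andP[kj0]; rewrite kj0 /=.
by have [->|ki] := eqVneq k i; rewrite ?p'i ?eqxx// p'k.
Qed.

Unset Implicit Arguments.

Theorem theorem4 (R : realType) (n : nat) (p0 theta : R)
    (hn : (1 <= n)%N) (hp0 : 0 <= p0 < 1)
    (htheta : 0 < theta <= (1 - p0) / n%:R)
    (p : 'rV[R]_n) (hp : A_ p0 theta p)
    (c : nat) (hc : (1 <= c <= n)%N)
    (q : 'rV[R]_n) (hq : B_ p0 theta q)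
    (d d' : measure_display)
    (Om : measurableType d) (Om' : measurableType d')
    (P : probability Om R) (P' : probability Om' R)
    (X : nat -> {RV P >-> 'I_n.+1}) (Y : nat -> {RV P' >-> 'I_n.+1})
    (hX : coupon_draws p X) (hY : coupon_draws q Y) :
  st_le P P' (collection_time c X) (collection_time c Y).
Proof.
(* For negative [t] both events are certain, since collection times are nonnegative. *)
move=> t; have [t0|t0] := ltP t 0.
  have T_gt d1 (Om1 : measurableType d1) (Q : probability Om1 R) Z :
      [set w | t%:E < @collection_time R n d1 Om1 Q c Z w]%E = setT.
    apply/seteqP; split => // w _ /=; apply: lt_le_trans (collection_time_ge0 _ _ _).
    by rewrite lte_fin.
  by rewrite !T_gt !probability_setT.
have T_gt d1 (Om1 : measurableType d1) (Q : probability Om1 R) Z :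
    [set w | t%:E < @collection_time R n d1 Om1 Q c Z w]%E =
    [set w | (#|collected (fun k => Z k w) (Num.truncn t)| < c)%N].
  by apply/seteqP; split => w /=; rewrite lt_collection_time.
rewrite !T_gt (prob_few_collected _ _ hX) (prob_few_collected _ _ hY) lee_fin.
case: hp => p01 p_sum p_ge; case: hq => j0 _ <-.
have /andP[theta0 _] := htheta; have /andP[p0_ge0 _] := hp0.
apply: (@few_distinct_prob_le_extreme _ _ _ _ theta j0) => //.
- exact: ltW.
- by rewrite p_sum; lra.
- by move=> j jj0; rewrite mxE (negPf jj0).
(* The value [gamma_] makes the entries of [q] sum to [1 - p0]; [hn] turns the cast of [n.-1] into
   [n%:R - 1]. *)
- rewrite p_sum (bigD1 j0)//= mxE eqxx.
  rewrite (eq_bigr (fun=> theta)); last by move=> j jj0; rewrite mxE (negPf jj0).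
  rewrite sumr_const cardC1 card_ord /gamma_ -[theta *+ _]mulr_natl.
  have -> : n.-1%:R = n%:R - 1 :> R.
    by rewrite -[in RHS](prednK hn) -natr1 addrK.
  by ring.
Qed.
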